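(* Suppose $a_1,a_2,b_1,b_2,c_1,c_2$ are positive constants with $a_2<a_1$, $b_2<b_1$, $c_2<c_1$, and let $A^n$, $B^n$, $C^n$ be three different iterative sequences (of real numbers, the superscript $n$ being the iteration index, with initial terms $A^0,B^0,C^0$). If, for $n=1,2,\ldots$, $$a_1A^n+b_1B^n+c_1C^n\le a_2A^{n-1}+b_2B^{n-1}+c_2C^{n-1},$$ then the following estimate holds: $$a_1A^n+b_1B^n+c_1C^n\le\max\Big\{\frac{a_2}{a_1},\frac{b_2}{b_1},\frac{c_2}{c_1}\Big\}^{n-1}\Big(a_2A^0+b_2B^0+c_2C^0\Big).$$
   Formalization: The three sequences A^n, B^n, C^n are additionally assumed to be nonnegative for all n, since for sequences of arbitrary real numbers the estimate can fail (terms of mixed sign with different ratios). *)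

(* Defs.v *)
From mathcomp Require Export all_boot all_order all_algebra.
From mathcomp Require Export reals.

(* Main.v *)
Require Import Defs.
Import Order.TTheory GRing.Theory Num.Theory.
Local Open Scope ring_scope.

(** Let [r] be the largest ratio. Then [a2 <= r * a1], and likewise for [b] and [c]; since the
    sequences are nonnegative, the right side of [step] is at most [r] times the left side at the
    previous index. Each iteration after the first thus gains a factor [r]. *)

Lemma ler_mul_of_ratio (R : realFieldType) (x y r t : R) :
  0 < y -> x / y <= r -> 0 <= t -> x * t <= r * (y * t).
Proof.
by move=> y_gt0; rewrite ler_pdivrMr // mulrA => xy t_ge0; exact: ler_wpM2r.
Qed.

Theorem lemma4p3 (R : realType) (a1 a2 b1 b2 c1 c2 : R) (A B C : nat -> R)
  (a1_gt0 : 0 < a1) (a2_gt0 : 0 < a2)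
  (b1_gt0 : 0 < b1) (b2_gt0 : 0 < b2)
  (c1_gt0 : 0 < c1) (c2_gt0 : 0 < c2)
  (a2_lt_a1 : a2 < a1) (b2_lt_b1 : b2 < b1) (c2_lt_c1 : c2 < c1)
  (A_ge0 : forall n : nat, 0 <= A n)
  (B_ge0 : forall n : nat, 0 <= B n)
  (C_ge0 : forall n : nat, 0 <= C n)
  (step : forall n : nat, (1 <= n)%N ->
     a1 * A n + b1 * B n + c1 * C n
       <= a2 * A n.-1 + b2 * B n.-1 + c2 * C n.-1) :
  forall n : nat, (1 <= n)%N ->
    a1 * A n + b1 * B n + c1 * C n
      <= Num.max (a2 / a1) (Num.max (b2 / b1) (c2 / c1)) ^+ n.-1
         * (a2 * A 0%N + b2 * B 0%N + c2 * C 0%N).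
Proof.
(* At index 1 the bound is [step] itself, with no factor [r]; hence the exponent [n.-1]. *)
case=> // n _; elim: n => [|n IHn]; first by rewrite expr0 mul1r; exact: step.
set r := Num.max _ _ in IHn *.
have r_ge0 : 0 <= r by rewrite le_max divr_ge0 // ltW.
apply: le_trans (step n.+2 isT) _.
(* One factor [r] is split off the power and [IHn] absorbs the rest, leaving a termwise
   comparison. *)
rewrite /= exprS -mulrA; apply: le_trans (ler_wpM2l r_ge0 IHn).
by rewrite !mulrDr; apply: lerD; [apply: lerD|];
  apply: ler_mul_of_ratio => //; rewrite !le_max lexx ?orbT.
Qed.
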